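(* Let $m_1,m_2,n\in\mathbb{N}$, $m=m_1+m_2$, $j=\mathrm{diag}\{I_{m_1},-I_{m_2}\}$. Let an initial Dirac system $$y_{k+1}(z)=\Big(I_m+\frac{\mathrm{i}}{z}C_k\Big)y_k(z),\qquad C_k=U_k^*jU_k\quad(k\in\mathbb{N}_0),$$ with $m\times m$ unitary matrices $U_k$, and an admissible triple $\{\alpha,S_0,\Lambda_0\}$ be given. Then the matrices $\Lambda_k$, $S_k$ and $\widetilde C_k$ are well-defined for all $k\in\mathbb{N}_0$ via the relations $$\Lambda_{k+1}=\Lambda_k+\mathrm{i}\alpha^{-1}\Lambda_kC_k,\qquad S_{k+1}=S_k+\alpha^{-1}S_k(\alpha^* )^{-1}+\alpha^{-1}\Lambda_kC_k\Lambda_k^*(\alpha^* )^{-1},$$ $$\widetilde C_k=C_k+\Lambda_k^*S_k^{-1}\Lambda_k-\Lambda_{k+1}^*S_{k+1}^{-1}\Lambda_{k+1}$$ (in particular, all $S_k$ are invertible). Moreover, the block vector function $$\Psi(t)=Y\mathrm{e}^{\mathrm{i}t\alpha},\qquad Y=\{Y_k\}_{k=0}^\infty,\qquad Y_k=\Lambda_k^*S_k^{-1},$$ satisfies the non-stationary system $$(I-\mathcal{S})\Psi''+\widetilde C\,\Psi'+\mathcal{S}\Psi=0,\qquad \Psi'=\frac{d}{dt}\Psi,$$ where $I$ is the identity operator, $\mathcal{S}$ is the semi-infinite block shift matrix and $\widetilde C=\mathrm{diag}\{\widetilde C_0,\widetilde C_1,\widetilde C_2,\dots\}$.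
   Context: All matrices have complex entries; $\mathbb{N}_0=\{0\}\cup\mathbb{N}$; $^*$ denotes conjugate transpose; $\sigma(\alpha)$ is the spectrum of $\alpha$. A triple $\{\alpha,S_0,\Lambda_0\}$ consisting of $n\times n$ matrices $\alpha$ and $S_0=S_0^*$ and an $n\times m$ matrix $\Lambda_0$ is called admissible if $0,\mathrm{i}\notin\sigma(\alpha)$, $S_0>0$ (positive definite), and $\alpha S_0-S_0\alpha^*=\mathrm{i}\Lambda_0\Lambda_0^*$. $Y$ and $\Psi(t)$ are semi-infinite block columns with $m\times n$ blocks $Y_k$ and $\Psi_k(t)=Y_k\mathrm{e}^{\mathrm{i}t\alpha}$ ($k\in\mathbb{N}_0$). The semi-infinite block matrix $\mathcal{S}$ has $m\times m$ blocks, with $I_m$ on the first block superdiagonal and zeros elsewhere, so $(\mathcal{S}\Psi)_k=\Psi_{k+1}$; block matrices act on block columns by formal (blockwise, finite) matrix multiplication, $(\widetilde C\Psi)_k=\widetilde C_k\Psi_k$, and differentiation in $t$ is blockwise. *)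

(* Defs.v *)
From mathcomp Require Export all_boot all_order all_algebra spectral.
From mathcomp Require Export all_classical all_reals all_analysis.
From mathcomp Require Export complex.
Export Order.TTheory GRing.Theory Num.Theory numFieldNormedType.Exports.

Set Implicit Arguments.
Unset Strict Implicit.
Unset Printing Implicit Defensive.

Local Open Scope ring_scope.
Local Open Scope classical_set_scope.
Local Open Scope sesquilinear_scope.

Definition posdefmx (C : numClosedFieldType) (n : nat) (A : 'M[C]_n) : Prop :=
  A = A ^t* /\
  forall u : 'cV[C]_n, u != 0 -> 0 < (u ^t* *m A *m u) ord0 ord0.

(* Spectra are stated with [eigenvalue], which is about row vectors; a square
   matrix has the same left and right eigenvalues. *)
Definition admissible (C : numClosedFieldType) (n m : nat)
    (alpha S0 : 'M[C]_n) (Lambda0 : 'M[C]_(n, m)) : Prop :=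
  [/\ ~~ eigenvalue alpha 0,
      ~~ eigenvalue alpha 'i,
      posdefmx S0 &
      alpha *m S0 - S0 *m alpha ^t* = 'i *: (Lambda0 *m Lambda0 ^t*)].

Definition sigmx (C : numClosedFieldType) (m1 m2 : nat) : 'M[C]_(m1 + m2) :=
  block_mx 1%:M 0 0 (- 1%:M).

(* The discrete Dirac system y_{k+1}(z) = (1 + ('i / z) C_k) y_k(z) is
   identified with its sequence of coefficients C_k = U_k^* j U_k. *)
Definition dirac_system (C : numClosedFieldType) (m1 m2 : nat)
    (Cs : nat -> 'M[C]_(m1 + m2)) : Prop :=
  exists U : nat -> 'M[C]_(m1 + m2),
    forall k, U k \is unitarymx /\ Cs k = (U k) ^t* *m sigmx C m1 m2 *m U k.

Section Darboux.
Variables (C : numClosedFieldType) (n m : nat).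
Variables (alpha S0 : 'M[C]_n) (Lambda0 : 'M[C]_(n, m)) (Cs : nat -> 'M[C]_m).

Fixpoint Lambdas (k : nat) : 'M[C]_(n, m) :=
  if k is k'.+1 then
    Lambdas k' + 'i *: (invmx alpha *m Lambdas k' *m Cs k')
  else Lambda0.

Fixpoint Ss (k : nat) : 'M[C]_n :=
  if k is k'.+1 then
    Ss k' + invmx alpha *m Ss k' *m invmx (alpha ^t*)
    + invmx alpha *m Lambdas k' *m Cs k' *m (Lambdas k') ^t*
        *m invmx (alpha ^t*)
  else S0.

Definition tildeC (k : nat) : 'M[C]_m :=
  Cs k + (Lambdas k) ^t* *m invmx (Ss k) *m Lambdas k
  - (Lambdas k.+1) ^t* *m invmx (Ss k.+1) *m Lambdas k.+1.

Definition Yblocks (k : nat) : 'M[C]_(m, n) :=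
  (Lambdas k) ^t* *m invmx (Ss k).

End Darboux.

(* Semi-infinite block matrices [A k l] acting on block columns [Y k]; the sum
   over [l] is a finitely supported one ([fsbig]) for the band matrices below. *)
Definition blockmul (C : numClosedFieldType) (m n : nat)
    (A : nat -> nat -> 'M[C]_m) (Y : nat -> 'M[C]_(m, n)) :
    nat -> 'M[C]_(m, n) :=
  fun k => \sum_(l \in [set: nat]) (A k l *m Y l).

Definition blockdiag (C : numClosedFieldType) (m : nat) (d : nat -> 'M[C]_m) :
    nat -> nat -> 'M[C]_m :=
  fun k l => if l == k then d k else 0.

Definition blockid (C : numClosedFieldType) (m : nat) :
    nat -> nat -> 'M[C]_m := blockdiag (fun=> 1%:M).

Definition blockshift (C : numClosedFieldType) (m : nat) :
    nat -> nat -> 'M[C]_m :=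
  fun k l => if l == k.+1 then 1%:M else 0.

Definition expmx (K : numFieldType) (n : nat) (A : 'M[K]_n) : 'M[K]_n :=
  lim (series (fun p : nat => (p`!%:R)^-1 *: A ^+ p) @ \oo).

(* The complex numbers over [R], typed as a [numClosedFieldType]: the topology
   of numeric fields is attached to such structures, not to [R[i]] itself. *)
Definition Cplx (R : realType) : numClosedFieldType := R[i].

Definition cplx_of_real (R : realType) (t : R) : Cplx R := (t%:C)%C.

Section Calculus.
Variable R : realType.

Definition diffquot (m n : nat) (F : R -> 'M[Cplx R]_(m, n)) (t h : R) :
    'M[Cplx R]_(m, n) :=
  (cplx_of_real h)^-1 *: (F (t + h) - F t).

(* [derivable] and [derive] need domain and codomain to be normed modules over
   the same field, hence do not cover complex matrix functions of a real
   variable. *)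
Definition mxderivable (m n : nat) (F : R -> 'M[Cplx R]_(m, n)) (t : R) : Prop :=
  cvg (diffquot F t @ 0^').

Definition mxderive (m n : nat) (F : R -> 'M[Cplx R]_(m, n)) (t : R) :
    'M[Cplx R]_(m, n) :=
  lim (diffquot F t @ 0^').

Definition blockderivable (m n : nat)
    (F : R -> nat -> 'M[Cplx R]_(m, n)) : Prop :=
  forall k t, mxderivable (F ^~ k) t.

Definition blockderive (m n : nat) (F : R -> nat -> 'M[Cplx R]_(m, n)) :
    R -> nat -> 'M[Cplx R]_(m, n) :=
  fun t k => mxderive (F ^~ k) t.

Definition Psi (m n : nat) (alpha : 'M[Cplx R]_n)
    (Y : nat -> 'M[Cplx R]_(m, n)) : R -> nat -> 'M[Cplx R]_(m, n) :=
  fun t k => Y k *m expmx (('i * cplx_of_real t) *: alpha).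

End Calculus.

(* Main.v *)
(* The identity [alpha S_k - S_k alpha^* = 'i Lambda_k Lambda_k^*] propagates
   along the recursion because [C_k] is a hermitian involution.  With it,
     S_{k+1} = T S_k T^* + alpha^-1 Lambda_k (C_k + 1) Lambda_k^* alpha^-*,
   where [T = 1 - 'i alpha^-1] is invertible as 'i is not an eigenvalue of
   [alpha], so positivity propagates too.  The key to the differential equation
   is the mixed identity
     (alpha + alpha^-1) S_k = S_{k+1} alpha^* + 'i Lambda_{k+1} Lambda_k^*,
   which gives, with [B = 'i alpha],
     (Y_k - Y_{k+1}) B^2 + tildeC_k Y_k B + Y_{k+1} = 0.
   The exponential is differentiated entrywise: the real and imaginary parts of
   each entry of [exp (t B)] are real power series in [t] with infinite radius
   of convergence. *)

Require Import Defs.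
From mathcomp Require Import ring.

Set Implicit Arguments.
Unset Strict Implicit.
Unset Printing Implicit Defensive.

Local Open Scope ring_scope.
Local Open Scope classical_set_scope.
Local Open Scope sesquilinear_scope.

(** * Conjugate transposes and positive definite matrices *)

Section ConjugateTranspose.
Variable C : numClosedFieldType.

Lemma trmxC_mul m n p (A : 'M[C]_(m, n)) (B : 'M[C]_(n, p)) :
  (A *m B) ^t* = B ^t* *m A ^t*.
Proof. by rewrite trmx_mul map_mxM. Qed.

Lemma trmxCD m n (A B : 'M[C]_(m, n)) : (A + B) ^t* = A ^t* + B ^t*.
Proof. by rewrite linearD map_mxD. Qed.

Lemma trmxCB m n (A B : 'M[C]_(m, n)) : (A - B) ^t* = A ^t* - B ^t*.
Proof. by rewrite linearB map_mxB. Qed.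

Lemma trmxCZ m n (c : C) (A : 'M[C]_(m, n)) : (c *: A) ^t* = c^* *: A ^t*.
Proof. by rewrite linearZ map_mxZ. Qed.

Lemma trmxC1 n : (1%:M : 'M[C]_n) ^t* = 1%:M.
Proof. by rewrite trmx1 map_mx1. Qed.

Lemma trmxC_inv n (A : 'M[C]_n) : (invmx A) ^t* = invmx (A ^t*).
Proof. by rewrite trmx_inv map_invmx. Qed.

Lemma trmxC_unit n (A : 'M[C]_n) : (A ^t* \in unitmx) = (A \in unitmx).
Proof. by rewrite map_unitmx unitmx_tr. Qed.

Lemma trmxC_mul_ge0 n (u : 'cV[C]_n) : 0 <= (u ^t* *m u) ord0 ord0.
Proof.
by rewrite mxE sumr_ge0 // => i _; rewrite !mxE mulrC mul_conjC_ge0.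
Qed.

Lemma eigenvalueN_unitmx n (A : 'M[C]_n) (z : C) :
  ~~ eigenvalue A z -> A - z%:M \in unitmx.
Proof.
by rewrite /eigenvalue /eigenspace negbK kermx_eq0 row_free_unit.
Qed.

Lemma posdefmx_unit n (S : 'M[C]_n) : posdefmx S -> S \in unitmx.
Proof.
case=> _ Spos; rewrite -row_free_unit -kermx_eq0.
apply/rowV0P => v /sub_kermxP vS0; apply/eqP/negPn/negP => v0.
(* The form is tested at the conjugate transpose of a left null vector [v], where it vanishes
   because [v *m S = 0]. *)
have := Spos (v ^t*); rewrite trmxCK vS0 mul0mx mxE ltxx => /(_ _)/negP.
by apply => //; rewrite map_mx_eq0 trmx_eq0.
Qed.

End ConjugateTranspose.

(** * One step of the recursion, from [S], [Lambda] to [S1], [Lambda1] *)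

Section Step.
Variables (C : numClosedFieldType) (n m : nat).
Variables (alpha S : 'M[C]_n) (Lambda : 'M[C]_(n, m)) (D : 'M[C]_m).
Hypotheses (alpha_unit : alpha \in unitmx)
  (alphaBi_unit : alpha - 'i%:M \in unitmx)
  (D_herm : D ^t* = D) (D_inv : D *m D = 1%:M)
  (S_pos : posdefmx S)
  (S_id : alpha *m S - S *m alpha ^t* = 'i *: (Lambda *m Lambda ^t*)).

Let beta := invmx alpha.
Let Lambda1 := Lambda + 'i *: (beta *m Lambda *m D).
Let S1 := S + beta *m S *m invmx (alpha ^t*)
  + beta *m Lambda *m D *m Lambda ^t* *m invmx (alpha ^t*).

Let bcE : invmx (alpha ^t*) = beta ^t*.
Proof. by rewrite -trmxC_inv. Qed.

Let acK : alpha ^t* *m beta ^t* = 1%:M.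
Proof. by rewrite -trmxC_mul mulVmx // trmxC1. Qed.

Let bcK : beta ^t* *m alpha ^t* = 1%:M.
Proof. by rewrite -trmxC_mul mulmxV // trmxC1. Qed.

Let S_idE : alpha *m S = S *m alpha ^t* + 'i *: (Lambda *m Lambda ^t*).
Proof. by rewrite -S_id addrC subrK. Qed.

(** Obtained from [S_id] by multiplying with [beta] on the left and [beta ^t*] on the right. *)
Let S_idV :
  S *m beta ^t* = beta *m S + 'i *: (beta *m (Lambda *m Lambda ^t*) *m beta ^t*).
Proof.
rewrite -[in LHS](mulKmx alpha_unit S) S_idE mulmxDr mulmxDl !mulmxA.
by rewrite -scalemxAr -scalemxAl mulmxA -[X in X + _]mulmxA acK mulmx1.
Qed.

Let Lambda1C : Lambda1 ^t* = Lambda ^t* - 'i *: (D *m Lambda ^t* *m beta ^t*).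
Proof.
by rewrite trmxCD trmxCZ !trmxC_mul D_herm conjCi scaleNr mulmxA.
Qed.

(** In the expansion of the right side, [D *m D = 1] removes [D] from the quadratic term, which is
    then the defect in [S_idV]. The terms linear in [D] come from the last summand of [S1], and the
    remaining one is the identity for [S]. *)
Lemma darboux_step_identity :
  alpha *m S1 - S1 *m alpha ^t* = 'i *: (Lambda1 *m Lambda1 ^t*).
Proof.
have eq1 : alpha *m S1 =
    alpha *m S + S *m beta ^t* + Lambda *m D *m Lambda ^t* *m beta ^t*.
  by rewrite /S1 !mulmxDr bcE !mulmxA mulmxV // !mul1mx.
have eq2 : S1 *m alpha ^t* =
    S *m alpha ^t* + beta *m S + beta *m (Lambda *m D *m Lambda ^t*).
  rewrite /S1 !mulmxDl bcE -!mulmxA bcK.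
  by rewrite !mulmx1.
have eq3 : Lambda1 *m Lambda1 ^t* = Lambda *m Lambda ^t*
    + 'i *: (beta *m (Lambda *m D *m Lambda ^t*))
    - 'i *: (Lambda *m D *m Lambda ^t* *m beta ^t*)
    + beta *m (Lambda *m Lambda ^t*) *m beta ^t*.
  rewrite Lambda1C /Lambda1 mulmxBr !mulmxDl -!scalemxAl -!scalemxAr !mulmxA.
  rewrite scalerA -expr2 sqrCi scaleN1r.
  rewrite -[beta *m Lambda *m D *m D]mulmxA D_inv mulmx1.
  by rewrite opprD addrA opprK.
rewrite eq1 eq2 eq3 S_idE S_idV !scalerDr scalerN !scalerA -expr2 sqrCi.
rewrite !scaleN1r opprK.
move: (S *m alpha ^t*) ('i *: (Lambda *m Lambda ^t*)) (beta *m S).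
move: ('i *: (beta *m (Lambda *m Lambda ^t*) *m beta ^t*)).
move: (Lambda *m D *m Lambda ^t* *m beta ^t*).
move: (beta *m (Lambda *m D *m Lambda ^t*)) => x1 x2 x3 x4 x5 x6.
by apply/matrixP => i j; rewrite !mxE; ring.
Qed.

(** The two terms containing [D] on the right side cancel, which leaves the identity for [S] with
    [beta *m S] added to both sides. *)
Lemma darboux_step_mixed :
  alpha *m S + beta *m S = S1 *m alpha ^t* + 'i *: (Lambda1 *m Lambda ^t*).
Proof.
rewrite S_idE /S1 /Lambda1 !mulmxDl bcE -!scalemxAl scalerDr scalerA.
rewrite -expr2 sqrCi scaleN1r -!mulmxA bcK !mulmx1.
move: (S *m alpha ^t*) ('i *: (Lambda *m Lambda ^t*)) (beta *m S).
move: (beta *m (Lambda *m _)) => x1 x2 x3 x4.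
by apply/matrixP => i j; rewrite !mxE; ring.
Qed.

(** The matrix factors as [alpha - 'i] times [beta]; here the condition that ['i] is not in the
    spectrum of [alpha] enters. *)
Let iBbeta_unit : 1%:M - 'i *: beta \in unitmx.
Proof.
have -> : 1%:M - 'i *: beta = (alpha - 'i%:M) *m beta.
  by rewrite mulmxBl mulmxV // mul_scalar_mx.
by rewrite unitmx_mul alphaBi_unit unitmx_inv.
Qed.

(* The sum of two nonnegative terms since [D + 1] is half its own square. *)
Lemma darboux_step_sum :
  S1 = (1%:M - 'i *: beta) *m S *m (1%:M - 'i *: beta) ^t*
    + 2%:R^-1 *: (beta *m Lambda *m (D + 1%:M)
                  *m ((D + 1%:M) *m Lambda ^t* *m beta ^t*)).
Proof.
have -> : beta *m Lambda *m (D + 1%:M) *m ((D + 1%:M) *m Lambda ^t* *m beta ^t*) =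
    2%:R *: (beta *m Lambda *m D *m Lambda ^t* *m beta ^t*
             + beta *m (Lambda *m Lambda ^t*) *m beta ^t*).
  have -> : 2%:R *: (beta *m Lambda *m D *m Lambda ^t* *m beta ^t*
             + beta *m (Lambda *m Lambda ^t*) *m beta ^t*) =
      beta *m Lambda *m (2%:R *: (D + 1%:M)) *m Lambda ^t* *m beta ^t*.
    by rewrite -scalemxAr -!scalemxAl mulmxDr mulmx1 !mulmxDl !mulmxA.
  rewrite !mulmxA -[beta *m Lambda *m _ *m _]mulmxA; congr (_ *m _ *m _ *m _).
  rewrite mulmxDr !mulmxDl D_inv !mulmx1 !mul1mx.
  by apply/matrixP => i j; rewrite !mxE; ring.
rewrite scalerA mulVf ?pnatr_eq0 // scale1r.
rewrite trmxCB trmxC1 trmxCZ conjCi scaleNr opprK.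
rewrite mulmxDr mulmx1 -scalemxAr !mulmxBl !mul1mx -!scalemxAl scalerBr scalerA.
(* By [S_idV] the two cross terms of the congruence add up to minus the term that the [1] in [D + 1]
   contributes. *)
rewrite -expr2 sqrCi scaleN1r opprK {1}S_idV scalerDr scalerA.
rewrite -expr2 sqrCi scaleN1r.
rewrite /S1 bcE.
move: (beta *m (Lambda *m Lambda ^t*) *m _) (beta *m _ *m _ *m _ *m _).
move: ('i *: (beta *m S)) (beta *m S *m _) => x1 x2 x3 x4.
by apply/matrixP => i j; rewrite !mxE; ring.
Qed.

Lemma darboux_step_posdef : posdefmx S1.
Proof.
case: S_pos => S_herm Spos.
have DC : (D + 1%:M) ^t* = D + 1%:M by rewrite trmxCD trmxC1 D_herm.
split.
  rewrite /S1 !trmxCD !trmxC_mul bcE !trmxCK D_herm.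
  by rewrite -[S in LHS]/S -S_herm !mulmxA.
move=> u u0; rewrite darboux_step_sum mulmxDr mulmxDl mxE.
apply: ltr_wpDr.
  rewrite -scalemxAr -scalemxAl mxE mulr_ge0 ?invr_ge0 ?ler0n //.
  (* The second summand of the quadratic form is half the squared norm of [v]. *)
  set v := (D + 1%:M) *m (Lambda ^t* *m (beta ^t* *m u)).
  rewrite (_ : u ^t* *m _ *m u = v ^t* *m v); first exact: trmxC_mul_ge0.
  by rewrite /v !trmxC_mul DC !trmxCK !mulmxA.
set T := 1%:M - _; rewrite !mulmxA -[_ *m _ *m u]mulmxA.
have -> : u ^t* *m T = (T ^t* *m u) ^t* by rewrite trmxC_mul trmxCK.
(* Strict positivity survives because the invertible [T ^t*] sends no nonzero vector to zero. *)
apply: Spos; apply: contraNneq u0 => Tu0.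
have TU : T ^t* \in unitmx by rewrite trmxC_unit.
by rewrite -[u](mulKmx TU) Tu0 mulmx0.
Qed.

(** After [B = 'i *: alpha] is inserted, the second-order terms are [Y1 *m alpha *m alpha + Y1] and
    [Y *m alpha *m alpha]. The mixed identity evaluates the first, the identity for [S] the second,
    and their difference cancels the first-order term. *)
Lemma darboux_step_equation :
  let Y := Lambda ^t* *m invmx S in
  let Y1 := Lambda1 ^t* *m invmx S1 in
  let B := 'i *: alpha in
  (Y - Y1) *m B *m B + (D + Y *m Lambda - Y1 *m Lambda1) *m Y *m B + Y1 = 0.
Proof.
have SU := posdefmx_unit S_pos; have S1U := posdefmx_unit darboux_step_posdef.
have mixed := darboux_step_mixed.
have baK : beta *m alpha = 1%:M by rewrite mulVmx.
have F3 : Lambda1 ^t* *m alpha ^t* =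
    Lambda ^t* *m alpha ^t* - 'i *: (D *m Lambda ^t*).
  by rewrite Lambda1C mulmxBl -scalemxAl -!mulmxA bcK mulmx1.
clear S_idV Lambda1C iBbeta_unit bcE acK bcK; clearbody S1 Lambda1 beta.
set X := invmx S; set X1 := invmx S1; move=> /=.
(* The mixed identity between [X1] and [X *m alpha]; the summand [beta *m S] becomes the isolated
   [X1]. *)
have F1 : X1 *m alpha *m alpha + X1 =
    alpha ^t* *m X *m alpha + 'i *: (X1 *m Lambda1 *m Lambda ^t* *m X *m alpha).
  have := congr1 (fun A => X1 *m A *m (X *m alpha)) mixed.
  rewrite /= -mulmxDl !mulmxA -[_ *m S *m X]mulmxA mulmxV // mulmx1.
  rewrite mulmxDr !mulmxDl.
  rewrite -[X1 *m beta *m alpha]mulmxA baK mulmx1 => ->.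
  rewrite mulmxDr !mulmxDl -scalemxAr -!scalemxAl !mulmxA.
  by rewrite mulVmx // mul1mx.
(* The identity for [S] with its inverse on both sides. *)
have F2 : X *m alpha = alpha ^t* *m X + 'i *: (X *m Lambda *m Lambda ^t* *m X).
  have := congr1 (fun A => X *m A *m X) S_idE.
  rewrite /= mulmxDr mulmxDl !mulmxA -[X *m alpha *m S *m X]mulmxA mulmxV //.
  rewrite mulmx1.
  by move=> ->; rewrite mulVmx // mul1mx -scalemxAr -scalemxAl !mulmxA.
(* Multiplication by [Lambda1 ^t*] turns [X1] into [Y1], and [F3] then replaces
   [Lambda1 ^t* *m alpha ^t*] by terms in [Lambda] and [D]. *)
have G1 := congr1 (mulmx (Lambda1 ^t*)) F1.
rewrite !mulmxDr -scalemxAr !mulmxA F3 !mulmxBl -!scalemxAl in G1.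
have G2 := congr1 (fun A => Lambda ^t* *m A *m alpha) F2.
rewrite /= mulmxDr mulmxDl -scalemxAr -scalemxAl !mulmxA in G2.
rewrite -!scalemxAr -!scalemxAl scalerA -expr2 sqrCi scaleN1r.
rewrite !(mulmxBl, mulmxDl) !mulmxA.
(* Zero is written as the left side of [G1] minus itself and only the second copy is replaced; the
   rest is a linear identity between six matrices. *)
rewrite -[RHS](subrr (Lambda1 ^t* *m X1 *m alpha *m alpha + Lambda1 ^t* *m X1)).
rewrite {2}G1 G2.
move: (Lambda ^t* *m alpha ^t* *m X *m alpha).
move: (D *m Lambda ^t* *m X *m alpha).
move: (Lambda ^t* *m X *m Lambda *m Lambda ^t* *m X *m alpha).
move: (Lambda1 ^t* *m X1 *m Lambda1 *m Lambda ^t* *m X *m alpha).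
move: (Lambda1 ^t* *m X1 *m alpha *m alpha) (Lambda1 ^t* *m X1).
move=> x1 x2 x3 x4 x5 x6.
by apply/matrixP => i j; rewrite !mxE; ring.
Qed.

End Step.

(** * Induction along the recursion *)

Section Darboux.
Variables (C : numClosedFieldType) (n m : nat).
Variables (alpha S0 : 'M[C]_n) (Lambda0 : 'M[C]_(n, m)) (Cs : nat -> 'M[C]_m).
Hypotheses (adm : admissible alpha S0 Lambda0)
  (Cs_herm : forall k, (Cs k) ^t* = Cs k)
  (Cs_inv : forall k, Cs k *m Cs k = 1%:M).

Lemma admissible_unit : alpha \in unitmx.
Proof.
by case: adm => /eigenvalueN_unitmx; rewrite raddf0 subr0.
Qed.

(** The two claims share one induction, since positivity at [k.+1] also uses the identity at [k]. *)
Lemma darboux_invariant k :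
  posdefmx (Ss alpha S0 Lambda0 Cs k) /\
  alpha *m Ss alpha S0 Lambda0 Cs k - Ss alpha S0 Lambda0 Cs k *m alpha ^t* =
    'i *: (Lambdas alpha Lambda0 Cs k *m (Lambdas alpha Lambda0 Cs k) ^t*).
Proof.
have aU := admissible_unit; case: adm => _ /eigenvalueN_unitmx aiU S0pos S0id.
elim: k => [//|k [Spos Sid]]; split.
  exact: (darboux_step_posdef aU aiU (Cs_herm k) (Cs_inv k) Spos Sid).
exact: (darboux_step_identity aU (Cs_herm k) (Cs_inv k) Sid).
Qed.

Lemma darboux_equation k :
  let Y := Yblocks alpha S0 Lambda0 Cs in
  let B := 'i *: alpha in
  (Y k - Y k.+1) *m B *m B + tildeC alpha S0 Lambda0 Cs k *m Y k *m B
    + Y k.+1 = 0.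
Proof.
have aU := admissible_unit; case: adm => _ /eigenvalueN_unitmx aiU _ _.
have [Spos Sid] := darboux_invariant k.
exact: (darboux_step_equation aU aiU (Cs_herm k) (Cs_inv k) Spos Sid).
Qed.

End Darboux.

(** * The coefficients of a Dirac system are hermitian involutions *)

Lemma dirac_system_herm (C : numClosedFieldType) (m1 m2 : nat)
    (Cs : nat -> 'M[C]_(m1 + m2)) k :
  dirac_system Cs -> (Cs k) ^t* = Cs k.
Proof.
case=> U /(_ k) [_ ->]; rewrite !trmxC_mul trmxCK mulmxA.
congr (_ *m _ *m _); rewrite /sigmx tr_block_mx map_block_mx.
by rewrite !trmx0 !map_mx0 trmxC1 linearN map_mxN trmxC1.
Qed.

Lemma dirac_system_inv (C : numClosedFieldType) (m1 m2 : nat)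
    (Cs : nat -> 'M[C]_(m1 + m2)) k :
  dirac_system Cs -> Cs k *m Cs k = 1%:M.
Proof.
case=> U /(_ k) [UU ->]; rewrite !mulmxA mulmxtVK //.
rewrite -[(U k)^t* *m _ *m _]mulmxA /sigmx mulmx_block.
rewrite !(mulmx0, mul0mx, addr0, add0r, mulmx1, mulNmx, mul1mx, opprK).
rewrite -scalar_mx_block mulmx1.
(* Unitarity is given as [U *m U ^t* = 1]; for square matrices the opposite order follows. *)
by apply: mulmx1C; apply/unitarymxP.
Qed.

(** * Real numbers inside the complex field *)

Lemma cplx_of_realV (R : realType) (x : R) :
  cplx_of_real x^-1 = (cplx_of_real x)^-1.
Proof. exact: (fmorphV (real_complex R)). Qed.

Lemma cplx_of_real_nat (R : realType) p : cplx_of_real (p%:R : R) = p%:R.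
Proof. exact: (rmorph_nat (real_complex R)). Qed.

Lemma cplx_of_realX (R : realType) (x : R) p :
  cplx_of_real (x ^+ p) = cplx_of_real x ^+ p.
Proof. exact: (rmorphXn (real_complex R)). Qed.

(** * Limits of matrices and of complex numbers, entrywise and by real and imaginary parts *)

Section Limits.

(** A neighbourhood of a matrix contains a product of neighbourhoods of its finitely many entries,
    and filters are closed under finite intersections. *)
Lemma cvg_mx_entry (K : numFieldType) (T : Type) (F : set_system T)
    (FF : Filter F) m n (f : T -> 'M[K]_(m, n)) (l : 'M[K]_(m, n)) :
  (forall i j, f x i j @[x --> F] --> l i j) -> f x @[x --> F] --> l.
Proof.
move=> fl A [P Pl PA]; rewrite /fmap /=.
have : \forall x \near F, forall i j, P i j (f x i j).
  by apply: filter_forall => i; apply: filter_forall => j; exact: fl.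
by apply: filterS => x Px; apply: PA.
Qed.

Lemma cvg_mulmxl (K : numFieldType) (T : Type) (F : set_system T)
    (FF : Filter F) m n p (A : 'M[K]_(m, n)) (f : T -> 'M[K]_(n, p)) l :
  f x @[x --> F] --> l -> A *m f x @[x --> F] --> A *m l.
Proof.
move=> fl; apply: cvg_mx_entry => i j; rewrite mxE.
under eq_fun do rewrite mxE.
apply: (cvg_big (op := +%R)) => [|k _]; first exact: add_continuous.
apply: cvgMr => //.
have := cvg_comp _ _ fl (@coord_continuous K n p k j l).
exact.
Qed.

Variable R : realType.

Lemma normc_le_ReIm (z : Cplx R) :
  `|z| <= cplx_of_real (`|complex.Re z| + `|complex.Im z|).
Proof.
rewrite normc_def lecR; set a := complex.Re z; set b := complex.Im z.
have ab0 : 0 <= `|a| + `|b| by rewrite addr_ge0.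
rewrite -[leRHS]ger0_norm // -[leRHS]sqrtr_sqr ler_wsqrtr // sqrrD.
by rewrite !real_normK ?num_real // addrAC lerDl mulrn_wge0 // mulr_ge0.
Qed.

Lemma cvg_complex (T : Type) (F : set_system T) (FF : Filter F)
    (f : T -> Cplx R) (l : Cplx R) :
  complex.Re (f x) @[x --> F] --> complex.Re l ->
  complex.Im (f x) @[x --> F] --> complex.Im l -> f x @[x --> F] --> l.
Proof.
move=> /cvgrPdist_lt fRe /cvgrPdist_lt fIm; apply/cvgrPdist_lt => e e0.
(* In the order on complex numbers a positive [e] has zero imaginary part, so it comes from a
   positive real. *)
have [e1 e1_gt0 ->] : exists2 e1 : R, 0 < e1 & e = cplx_of_real e1.
  move: e e0 => [a b]; rewrite ltcE /= => /andP[/eqP-> a0].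
  by exists a.
have e2 : 0 < e1 / 2 by rewrite divr_gt0.
near=> x.
apply: le_lt_trans (normc_le_ReIm _) _; rewrite ltcR !raddfB /= (splitr e1).
by apply: ltrD; near: x; [exact: fRe | exact: fIm].
Unshelve. all: by end_near.
Qed.

Lemma cvg_complex_mx (T : Type) (F : set_system T) (FF : Filter F) m n
    (f : T -> 'M[Cplx R]_(m, n)) (l : 'M[Cplx R]_(m, n)) :
  (forall i j, complex.Re (f x i j) @[x --> F] --> complex.Re (l i j)) ->
  (forall i j, complex.Im (f x i j) @[x --> F] --> complex.Im (l i j)) ->
  f x @[x --> F] --> l.
Proof. by move=> fRe fIm; apply: cvg_mx_entry => i j; apply: cvg_complex. Qed.

End Limits.

(** * Termwise differentiation of real power series *)

Section PowerSeries.
Variable R : realType.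
Implicit Types (c : R ^nat) (A K : R).

(** Domination by the Taylor coefficients of [A * exp (K * x)]: this forces convergence everywhere
    and is stable under formal differentiation. *)
Definition exp_bounded c A K := forall p, `|c p| <= A * K ^+ p / p`!%:R.

Lemma exp_bounded_pseries c A K x :
  0 <= A -> 0 <= K -> exp_bounded c A K -> cvgn (pseries c x).
Proof.
move=> A0 K0 cb; apply: normed_cvg.
apply: (@series_le_cvg _ _ (A *: exp_coeff (K * `|x|))).
- by move=> p; exact: normr_ge0.
- by move=> p; rewrite mulr_ge0 // divr_ge0 // exprn_ge0 // mulr_ge0.
- move=> p; rewrite /= normrM normrX.
  apply: (le_trans (ler_wpM2r _ (cb p))); first exact: exprn_ge0.
  rewrite (_ : (A *: _) p = A * ((K * `|x|) ^+ p / p`!%:R)) // exprMn.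
  by rewrite le_eqVlt; apply/orP; left; apply/eqP; ring.
- exact: is_cvg_seriesZ (is_cvg_series_exp_coeff _).
Qed.

(** The factor [p.+1] of the formal derivative reduces [p.+1] factorial to [p] factorial, and the
    extra power of [K] moves into the constant. *)
Lemma exp_bounded_diffs c A K :
  exp_bounded c A K -> exp_bounded (pseries_diffs c) (A * K) K.
Proof.
move=> cb p; rewrite /pseries_diffs normrM normr_nat.
apply: le_trans (ler_wpM2l _ (cb p.+1)) _ => //.
rewrite factS natrM exprS le_eqVlt; apply/orP; left; apply/eqP.
by field; rewrite ?pnatr_eq0 -?lt0n ?fact_gt0 //= -natr1 natr1 pnatr_eq0.
Qed.

Lemma exp_bounded_derive c A K x : 0 <= A -> 0 <= K -> exp_bounded c A K ->
  h^-1 * (limn (pseries c (x + h)) - limn (pseries c x)) @[h --> 0^'] -->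
  limn (pseries (pseries_diffs c) x).
Proof.
move=> A0 K0 cb; have cb1 := exp_bounded_diffs cb.
have cb2 := exp_bounded_diffs cb1.
have AK0 : 0 <= A * K by rewrite mulr_ge0.
(* Termwise differentiation at [x] asks for convergence of the series and of its first two formal
   derivatives at a point of larger modulus. *)
have xL : `|x| < `| `|x| + 1 |.
  by rewrite [ltRHS]ger0_norm ?addr_ge0 // ltrDl.
have [dc <-] := pseries_snd_diffs (exp_bounded_pseries A0 K0 cb)
  (exp_bounded_pseries AK0 K0 cb1)
  (exp_bounded_pseries (mulr_ge0 AK0 K0) K0 cb2) xL.
have -> : (fun h => h^-1 * (limn (pseries c (x + h)) - limn (pseries c x))) =
    (fun h => h^-1 *: (((fun y => limn (pseries c y)) \o shift x) (h *: (1 : R))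
                      - limn (pseries c x))).
  by apply/funext => h; rewrite /= [h *: _]mulr1 [x + h]addrC.
by move: dc; rewrite /derivable /derive.
Qed.

End PowerSeries.

(** * Convergence and derivative of the matrix exponential *)

Section MatrixExponential.
Variables (R : realType) (n : nat) (B : 'M[Cplx R]_n).
Implicit Types (t : R) (p N : nat) (i j : 'I_n).

(** The sum of the moduli of all entries, moved to [R]. It dominates every row sum, so [K ^+ p]
    bounds the entries of [B ^+ p]. *)
Let K : R := complex.Re (\sum_i \sum_j `|B i j|).

Let KE : cplx_of_real K = \sum_i \sum_j `|B i j|.
Proof.
apply: RRe_real; apply: ger0_real; apply: sumr_ge0 => i _.
by apply: sumr_ge0 => j _; exact: normr_ge0.
Qed.

Let K0 : 0 <= K.
Proof.
have : 0 <= cplx_of_real K.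
  by rewrite KE; apply: sumr_ge0 => i _; apply: sumr_ge0 => j _; exact: normr_ge0.
by rewrite ler0c.
Qed.

Lemma norm_exprmx_le p i j : `|(B ^+ p) i j| <= cplx_of_real (K ^+ p).
Proof.
elim: p i j => [|p IHp] i j.
  rewrite !expr0 mxE; case: (i == j); first by rewrite normr1.
  by rewrite normr0 lecR ler01.
rewrite exprS mxE; apply: le_trans (ler_norm_sum _ _ _) _.
apply: (@le_trans _ _ (\sum_k `|B i k| * cplx_of_real (K ^+ p))).
  by apply: ler_sum => k _; rewrite normrM ler_wpM2l.
rewrite -mulr_suml exprS /cplx_of_real rmorphM ler_wpM2r //.
  by rewrite ler0c exprn_ge0.
rewrite [leRHS]KE [leRHS](bigD1 i) //= lerDl.
by apply: sumr_ge0 => k _; apply: sumr_ge0 => l _; exact: normr_ge0.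
Qed.

Definition expmx_coef p : 'M[Cplx R]_n := (p`!%:R)^-1 *: B ^+ p.

Let exp_series t := series (fun p => (p`!%:R)^-1 *: (cplx_of_real t *: B) ^+ p).

Lemma exprmxZ (a : Cplx R) p : (a *: B) ^+ p = a ^+ p *: B ^+ p.
Proof.
elim: p => [|p IHp]; first by rewrite !expr0 scale1r.
rewrite exprS IHp -[LHS]/((a *: B) *m (a ^+ p *: B ^+ p)).
by rewrite -scalemxAl -scalemxAr scalerA -exprS [B ^+ p.+1]exprS.
Qed.

(* [phi] stands for the real part or the imaginary part. *)
Section Coordinate.
Variable phi : Cplx R -> R.
Hypotheses (phiD : {morph phi : x y / x + y})
  (phiZ : forall r z, phi (cplx_of_real r * z) = r * phi z)
  (phi_le : forall z, cplx_of_real `|phi z| <= `|z|).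

Lemma phi_sum m (F : nat -> Cplx R) :
  phi (\sum_(0 <= k < m) F k) = \sum_(0 <= k < m) phi (F k).
Proof.
apply: (big_morph phi phiD).
by have := phiZ 0 0; rewrite mulr0 mul0r.
Qed.

Let c i j p := phi (expmx_coef p i j).

Lemma expmx_coef_bounded i j : exp_bounded (c i j) 1 K.
Proof.
move=> p; rewrite /c mxE mul1r.
have -> : (p`!%:R)^-1 = cplx_of_real (p`!%:R^-1 : R).
  by rewrite cplx_of_realV cplx_of_real_nat.
rewrite phiZ normrM ger0_norm ?invr_ge0 ?ler0n // mulrC.
rewrite ler_wpM2r ?invr_ge0 ?ler0n //.
by rewrite -lecR; apply: le_trans (phi_le _) (norm_exprmx_le _ _ _).
Qed.

Lemma exp_series_coord t N i j : phi (exp_series t N i j) = pseries (c i j) t N.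
Proof.
rewrite /exp_series /pseries /series /= summxE phi_sum; apply: eq_bigr => p _.
rewrite exprmxZ !mxE mulrCA -cplx_of_realX.
by rewrite phiZ mulrC /c mxE.
Qed.

(** Multiplication by [B] is formal differentiation: [B] times [B ^+ p / p!] equals [p.+1] times the
    next coefficient. *)
Lemma mul_exp_series_coord t N i j :
  phi ((B *m exp_series t N) i j) = pseries (pseries_diffs (c i j)) t N.
Proof.
rewrite /exp_series /pseries /series /= mulmx_sumr summxE phi_sum.
apply: eq_bigr => p _; rewrite /pseries_diffs /c /expmx_coef.
rewrite exprmxZ -!scalemxAr exprS [in RHS]mxE [LHS]/=.
rewrite -phiZ [RHS]mulrC -phiZ !mxE; congr phi.
rewrite cplx_of_realX cplx_of_real_nat factS natrM invfM mulrCA.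
by rewrite -[_ / _ * _]mulrA mulVKf // pnatr_eq0.
Qed.

Lemma expmx_coef_cvg t i j :
  pseries (c i j) t @ \oo --> limn (pseries (c i j) t).
Proof. exact: exp_bounded_pseries ler01 K0 (expmx_coef_bounded i j). Qed.

Lemma expmx_coef_diffs_cvg t i j :
  pseries (pseries_diffs (c i j)) t @ \oo -->
  limn (pseries (pseries_diffs (c i j)) t).
Proof.
by apply: (exp_bounded_pseries _ K0 (exp_bounded_diffs (expmx_coef_bounded i j)));
  rewrite mul1r.
Qed.

Lemma expmx_coef_derive t i j :
  h^-1 * (limn (pseries (c i j) (t + h)) - limn (pseries (c i j) t))
    @[h --> 0^'] --> limn (pseries (pseries_diffs (c i j)) t).
Proof. exact: exp_bounded_derive ler01 K0 (expmx_coef_bounded i j). Qed.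

End Coordinate.

Let ReD : {morph (@complex.Re R : Cplx R -> R) : x y / x + y}.
Proof. by case=> [a b] [c d]. Qed.

Let ImD : {morph (@complex.Im R : Cplx R -> R) : x y / x + y}.
Proof. by case=> [a b] [c d]. Qed.

Let ReZ (r : R) (z : Cplx R) :
  complex.Re (cplx_of_real r * z) = r * complex.Re z.
Proof. by case: z => [a b]; rewrite /= mul0r subr0. Qed.

Let ImZ (r : R) (z : Cplx R) :
  complex.Im (cplx_of_real r * z) = r * complex.Im z.
Proof. by case: z => [a b]; rewrite /= mul0r addr0. Qed.

Let Re_le (z : Cplx R) : cplx_of_real `|complex.Re z| <= `|z|.
Proof. exact: normc_ge_Re. Qed.

Let Im_le (z : Cplx R) : cplx_of_real `|complex.Im z| <= `|z|.
Proof.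
(* Up to sign, the imaginary part of [z] is the real part of [z * 'i], which has the same modulus as
   [z]. *)
have := normc_ge_Re (z * 'i%C); rewrite ReiNIm normrN normrM.
by rewrite complexiE normCi mulr1.
Qed.

Let coef (phi : Cplx R -> R) i j p := phi (expmx_coef p i j).

(** The operator [D] acts on coefficient sequences: [id] yields the exponential and [pseries_diffs]
    its derivative. *)
Let powersum (D : (R ^nat) -> (R ^nat)) t : 'M[Cplx R]_n :=
  \matrix_(i, j) Complex (limn (pseries (D (coef (@complex.Re R) i j)) t))
                         (limn (pseries (D (coef (@complex.Im R) i j)) t)).

Let exp_series_cvg t : exp_series t @ \oo --> powersum id t.
Proof.
apply: cvg_complex_mx => i j; rewrite mxE /=.
  under eq_fun do rewrite (exp_series_coord ReD ReZ).
  exact: expmx_coef_cvg ReZ Re_le _ _ _.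
under eq_fun do rewrite (exp_series_coord ImD ImZ).
exact: expmx_coef_cvg ImZ Im_le _ _ _.
Qed.

Let mul_exp_series_cvg t :
  B *m exp_series t N @[N --> \oo] --> powersum (@pseries_diffs R) t.
Proof.
apply: cvg_complex_mx => i j; rewrite mxE /=.
  under eq_fun do rewrite (mul_exp_series_coord ReD ReZ).
  exact: expmx_coef_diffs_cvg ReZ Re_le _ _ _.
under eq_fun do rewrite (mul_exp_series_coord ImD ImZ).
exact: expmx_coef_diffs_cvg ImZ Im_le _ _ _.
Qed.

Let expmxE t : expmx (cplx_of_real t *: B) = powersum id t.
Proof.
have := @cvg_lim 'M[Cplx R]_n (@norm_hausdorff _ _) _ _ _ _ _ (@exp_series_cvg t).
exact.
Qed.

Lemma expmx_derive t :
  diffquot (fun s => expmx (cplx_of_real s *: B)) t h @[h --> 0^'] -->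
  B *m expmx (cplx_of_real t *: B).
Proof.
(* Both sides are limits of [B] times the partial sums, so they agree by uniqueness of limits. *)
have -> : B *m expmx (cplx_of_real t *: B) = powersum (@pseries_diffs R) t.
  rewrite expmxE.
  apply: (cvg_unique _ _ (@mul_exp_series_cvg t)); first exact: norm_hausdorff.
  exact: cvg_mulmxl (@exp_series_cvg t).
(* The increment [h] is real, so the real and imaginary parts of each entry are ordinary real
   difference quotients. *)
have dqE h i j : (diffquot (fun s => expmx (cplx_of_real s *: B)) t h) i j =
    cplx_of_real h^-1 * (powersum id (t + h) i j - powersum id t i j).
  by rewrite /diffquot !expmxE cplx_of_realV !mxE.
apply: cvg_complex_mx => i j; rewrite mxE /=.
  under eq_fun do rewrite dqE ReZ !mxE /=.
  exact: expmx_coef_derive ReZ Re_le _ _ _.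
under eq_fun do rewrite dqE ImZ !mxE /=.
exact: expmx_coef_derive ImZ Im_le _ _ _.
Qed.

End MatrixExponential.

(** * Derivatives of [Psi], block operators and the differential system *)

Section Assembly.
Variables (R : realType) (m n : nat).

Lemma mulmx_expmx_derive (A : 'M[Cplx R]_(m, n)) (B : 'M[Cplx R]_n) (t : R) :
  diffquot (fun s => A *m expmx (cplx_of_real s *: B)) t h @[h --> 0^'] -->
  A *m B *m expmx (cplx_of_real t *: B).
Proof.
have -> : diffquot (fun s => A *m expmx (cplx_of_real s *: B)) t =
    (fun h => A *m diffquot (fun s => expmx (cplx_of_real s *: B)) t h).
  by apply/funext => h; rewrite /diffquot -scalemxAr mulmxBr.
by rewrite -mulmxA; apply: cvg_mulmxl; exact: expmx_derive.
Qed.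

Lemma PsiE (alpha : 'M[Cplx R]_n) (Y : nat -> 'M[Cplx R]_(m, n)) t k :
  Psi alpha Y t k = Y k *m expmx (cplx_of_real t *: ('i *: alpha)).
Proof. by rewrite /Psi scalerA mulrC. Qed.

(** The derivative is again of the form [Psi alpha _], so the lemma applies a second time to give
    the second derivative. *)
Lemma Psi_derive (alpha : 'M[Cplx R]_n) (Y : nat -> 'M[Cplx R]_(m, n)) :
  blockderivable (Psi alpha Y) /\
  blockderive (Psi alpha Y) = Psi alpha (fun k => Y k *m ('i *: alpha)).
Proof.
have dPsi k t : diffquot (fun s => Psi alpha Y s k) t h @[h --> 0^'] -->
    Psi alpha (fun k => Y k *m ('i *: alpha)) t k.
  rewrite PsiE.
  have -> : (fun s => Psi alpha Y s k) =
      (fun s => Y k *m expmx (cplx_of_real s *: ('i *: alpha))).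
    by apply/funext => s; rewrite PsiE.
  exact: mulmx_expmx_derive.
split; first by move=> k t; apply/cvg_ex; eexists; exact: dPsi.
apply/funext => t; apply/funext => k.
have := @cvg_lim 'M[Cplx R]_(m, n) (@norm_hausdorff _ _) _ _ _ _ _ (@dPsi k t).
exact.
Qed.

(** Covers every operator of the system: each has nonzero blocks only on the diagonal and the first
    superdiagonal. *)
Lemma blockmul_band (A : nat -> nat -> 'M[Cplx R]_m)
    (Y : nat -> 'M[Cplx R]_(m, n)) k :
  (forall l, l != k -> l != k.+1 -> A k l = 0) ->
  blockmul A Y k = A k k *m Y k + A k k.+1 *m Y k.+1.
Proof.
move=> A0; rewrite /blockmul (fsbigE [:: k; k.+1]) //=.
- by rewrite !big_cons big_nil !in_setT addr0.
- by rewrite inE -(eqn_add2l 0) ltn_eqF.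
- by move=> l _; rewrite !inE negb_or => /andP[lk lk1]; rewrite A0 ?mul0mx.
Qed.

Lemma blockmul_diag (d : nat -> 'M[Cplx R]_m) (Y : nat -> 'M[Cplx R]_(m, n)) k :
  blockmul (blockdiag d) Y k = d k *m Y k.
Proof.
rewrite blockmul_band /blockdiag ?eqxx ?gtn_eqF // => [|l /negPf-> //].
by rewrite mul0mx addr0.
Qed.

Lemma blockmul_shift (Y : nat -> 'M[Cplx R]_(m, n)) k :
  blockmul (blockshift (Cplx R) m) Y k = Y k.+1.
Proof.
rewrite blockmul_band /blockshift ?eqxx ?ltn_eqF // => [|l _ /negPf-> //].
by rewrite mul0mx add0r mul1mx.
Qed.

Lemma blockmul_id_sub_shift (Y : nat -> 'M[Cplx R]_(m, n)) k :
  blockmul (blockid (Cplx R) m - blockshift (Cplx R) m) Y k = Y k - Y k.+1.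
Proof.
rewrite blockmul_band /blockid /blockdiag /blockshift !fctE; last first.
  by move=> l /negPf-> /negPf->; rewrite subr0.
rewrite !eqxx ltn_eqF // gtn_eqF // subr0 sub0r.
by rewrite mulNmx !mul1mx.
Qed.

End Assembly.

(** Since [invmx] is total, well-definedness is expressed as invertibility of every matrix whose
    inverse occurs in the recursion or in [tildeC]. *)
Theorem theorem3p1 (R : realType) (m1 m2 n : nat)
    (hm1 : (0 < m1)%N) (hm2 : (0 < m2)%N) (hn : (0 < n)%N)
    (Cs : nat -> 'M[Cplx R]_(m1 + m2))
    (alpha S0 : 'M[Cplx R]_n) (Lambda0 : 'M[Cplx R]_(n, m1 + m2))
    (hC : dirac_system Cs) (hadm : admissible alpha S0 Lambda0) :
  (alpha \in unitmx /\ alpha ^t* \in unitmx /\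
   forall k : nat, Ss alpha S0 Lambda0 Cs k \in unitmx) /\
  (let Id := blockid (Cplx R) (m1 + m2) in
   let Sh := blockshift (Cplx R) (m1 + m2) in
   let Ct := blockdiag (tildeC alpha S0 Lambda0 Cs) in
   let P := Psi alpha (Yblocks alpha S0 Lambda0 Cs) in
   blockderivable P /\ blockderivable (blockderive P) /\
   forall t : R,
     blockmul (Id - Sh) (blockderive (blockderive P) t)
     + blockmul Ct (blockderive P t)
     + blockmul Sh (P t) = 0).
Proof.
have Cs_herm k : (Cs k) ^t* = Cs k := dirac_system_herm k hC.
have Cs_inv k : Cs k *m Cs k = 1%:M := dirac_system_inv k hC.
have aU := admissible_unit hadm.
split.
  split=> //; split=> [|k]; first by rewrite trmxC_unit.
  exact: posdefmx_unit (darboux_invariant hadm Cs_herm Cs_inv k).1.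
move=> Id Sh Ct P; set Y := Yblocks alpha S0 Lambda0 Cs.
have [dP P1E] := Psi_derive alpha Y.
have [dP1 P2E] := Psi_derive alpha (fun k => Y k *m ('i *: alpha)).
rewrite -/Y in P *; rewrite /P P1E P2E; split=> //; split=> // t.
apply/funext => k; rewrite [LHS]/=.
rewrite -[LHS]/(blockmul _ _ k + blockmul _ _ k + blockmul _ _ k).
rewrite blockmul_id_sub_shift blockmul_diag blockmul_shift !PsiE.
(* The exponential factors out on the right of the [k]-th block and leaves the algebraic equation
   for [Y k] and [Y k.+1]. *)
rewrite -mulmxBl -mulmxBl mulmxA -!mulmxDl mulmxA -mulmxBl.
by rewrite (darboux_equation hadm Cs_herm Cs_inv k) mul0mx.
Qed.
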